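(* Let $n\ge1$, $r\in(1,\infty)$, and let $V$ be a finite positive measure on $\mathbb{R}^n$ absolutely continuous with respect to Lebesgue measure. Suppose $g\in L^1(\mathbb{R}^n)$ and $T_g$ is bounded from $L^1(\mathbb{R}^n)$ to $L^{r,\infty}(\mathbb{R}^n)$. Then: (1) $g\in L^{r,\infty}$ and $\|g\|_{L^{r,\infty}}\le C\|T_g\|_{L^1\to L^{r,\infty}}$ with $C$ an absolute constant; (2) for every $\lambda>0$, $\lim_{t\to0^+}|\{x\in\mathbb{R}^n:|T_g(V_t)(x)-g(x)V(\mathbb{R}^n)|>\lambda\}|=0$.
   Context: $T_g(\mu)(x)=\int_{\mathbb{R}^n}g(x-y)\,d\mu(y)$ (for functions, $T_gf=g*f$). $V_t(E)=V(E/t)$ with $E/t=\{x/t:x\in E\}$. $L^{r,\infty}$ is weak $L^r$ with quasinorm $\sup_{\lambda>0}\lambda|\{|f|>\lambda\}|^{1/r}$. *)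

(* Defs.v *)
(* R^n is modelled as [n.-tuple R] with its
   canonical product (Borel) sigma-algebra from measurable_structure.v. *)
From HB Require Import structures.
From mathcomp Require Import all_boot all_order all_algebra.
From mathcomp Require Import all_classical all_reals all_analysis measurable_realfun.
Set Implicit Arguments. Unset Strict Implicit. Unset Printing Implicit Defensive.
Import Order.TTheory GRing.Theory Num.Theory.
Local Open Scope classical_set_scope.
Local Open Scope ring_scope.

Section defs.
Context {R : realType} {n : nat}.
Local Notation Rn := (n.-tuple R).
Local Notation dRn := (measure_tuple_display (R.-ocitv).-measurable).

Definition vsub (x y : Rn) : Rn := [tuple tnth x i - tnth y i | i < n].
Definition vscale (t : R) (y : Rn) : Rn := [tuple t * tnth y i | i < n].

(* mu is Lebesgue measure on the Borel sets of R^n: it assigns to every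
   closed box its volume (this determines a measure on the Borel sets). *)
Definition is_lebesgue_measure (mu : {measure set Rn -> \bar R}) :=
  forall a b : Rn, (forall i, tnth a i <= tnth b i) ->
    mu [set x | forall i, tnth a i <= tnth x i <= tnth b i] =
    (\prod_(i < n) (tnth b i - tnth a i))%:E.

Definition L1norm (mu : {measure set Rn -> \bar R}) (f : Rn -> R) : \bar R :=
  (\int[mu]_x (`|f x|)%:E)%E.
Definition inL1 (mu : {measure set Rn -> \bar R}) (f : Rn -> R) :=
  measurable_fun [set: Rn] f /\ mu.-integrable [set: Rn] (EFin \o f).

Definition weakLnorm (mu : {measure set Rn -> \bar R}) (r : R) (f : Rn -> R)
  : \bar R :=
  ereal_sup [set (l%:E * (mu [set x | (l < `|f x|)%R]) `^ r^-1)%E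
            | l in [set l : R | 0 < l]].

Definition conv (mu : {measure set Rn -> \bar R}) (g f : Rn -> R) : Rn -> R :=
  fun x => Rintegral mu [set: Rn] (fun y => g (vsub x y) * f y).

(* operator norm of T_g : L^1 -> L^{r,oo} (+oo if unbounded) *)
Definition opnorm_L1_weakLr (mu : {measure set Rn -> \bar R}) (r : R)
  (g : Rn -> R) : \bar R :=
  ereal_inf [set K%:E | K in [set K : R | 0 <= K /\
     forall f, inL1 mu f -> (weakLnorm mu r (conv mu g f) <= K%:E * L1norm mu f)%E]].

Lemma measurable_vscale t : measurable_fun [set: Rn] (vscale t).
Proof.
apply/measurable_fun_tnthP => i.
have -> : (@tnth n R ^~ i \o vscale t) = ((fun _ : Rn => t) \* (@tnth n R ^~ i)).
  by apply: funext => y /=; rewrite tnth_mktuple.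
apply: measurable_funM; first exact: measurable_cst.
exact: measurable_tnth.
Qed.

Definition dilate (V : {measure set Rn -> \bar R}) (t : R) : set Rn -> \bar R :=
  pushforward V (vscale t).

Section dilate_measure.
Variables (V : {measure set Rn -> \bar R}) (t : R).
Let mf := measurable_vscale t.
Let d0 : dilate V t set0 = 0%E.
Proof. by rewrite /dilate /pushforward preimage_set0 measure0. Qed.
Let dge0 A : (0 <= dilate V t A)%E.
Proof. exact: measure_ge0. Qed.
Let dsig : semi_sigma_additive (dilate V t).
Proof.
move=> F mF tF mUF; rewrite /dilate /pushforward preimage_bigcup.
apply: measure_semi_sigma_additive.
- by move=> k; rewrite -[X in measurable X]setTI; exact: mf.
- apply/trivIsetP => /= i j _ _ ij; rewrite -preimage_setI.
  by move/trivIsetP : tF => /(_ _ _ _ _ ij) ->//; rewrite preimage_set0.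
- by rewrite -preimage_bigcup -[X in measurable X]setTI; exact: mf.
Qed.
HB.instance Definition _ := isMeasure.Build _ _ _ (dilate V t) d0 dge0 dsig.
End dilate_measure.

Definition convm (nu : {measure set Rn -> \bar R}) (g : Rn -> R) : Rn -> R :=
  fun x => Rintegral nu [set: Rn] (fun y => g (vsub x y)).

End defs.

(* Main.v *)
(* Translation is continuous in L^1: w(y) = |g(. - y) - g|_1 tends to 0 as
   y -> 0. For a finite measure nu, Tonelli's theorem and Markov's inequality give
     l |{|g * nu - nu(R^n) g| > l}| <= int w dnu
       <= sup_Q w nu(R^n) + 2 |g|_1 nu(R^n \ Q)    for every cube Q around 0.
   With nu = V_t this is (2). With nu = 1_Q dx the last term vanishes, so g is
   close in measure to T_g(1_Q) / |Q|, and the weak-type bound for 1_Q / |Q|, of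
   L^1 norm 1, passes to g; splitting the level l in two halves gives C = 2. *)
Require Import Defs.
From HB Require Import structures.
From mathcomp Require Import all_boot all_order all_algebra.
From mathcomp Require Import all_classical all_reals all_analysis measurable_realfun ring lra.
Set Implicit Arguments.
Unset Strict Implicit.
Unset Printing Implicit Defensive.
Import Order.TTheory GRing.Theory Num.Theory.
Local Open Scope classical_set_scope.
Local Open Scope ring_scope.

(** * Measure-theoretic preliminaries: continuity from above, limits at zero, superlevel sets *)

(** Continuity from above at the empty set, in epsilon form. It serves both for the tails of a
    finite measure outside growing cubes and for the remainders of an increasing union. *)
Lemma nonincreasing_measure_lt d (T : measurableType d) (R : realType)
    (nu : {measure set T -> \bar R}) (G : (set T)^nat) (e : R) :
  (nu (G 0%N) < +oo)%E -> (forall k, measurable (G k)) ->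
  nonincreasing_seq G -> \bigcap_k G k = set0 -> 0 < e ->
  exists k, (nu (G k) < e%:E)%E.
Proof.
move=> G0 mG niG G_0 e0.
have := nonincreasing_cvg_mu G0 mG _ niG.
rewrite G_0 measure0 => /(_ measurable0) /fine_cvgP[Gfin].
move/cvgr_lt => /(_ e e0) Ge.
near \oo => k; exists k.
have Gk : (nu \o G) k \is a fin_num by near: k; exact: Gfin.
rewrite -[nu (G k)]/((nu \o G) k) -(fineK Gk) lte_fin; near: k; exact: Ge.
Unshelve. all: by end_near. Qed.

Lemma ge0_cvge0 (R : realType) (T : Type) (F : set_system T) (FF : Filter F)
    (f : T -> \bar R) : (forall x, 0 <= f x)%E ->
  (forall e : R, 0 < e -> \forall x \near F, (f x <= e%:E)%E) ->
  f x @[x --> F] --> 0%E.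
Proof.
move=> f0 fe.
have ffin (e : R) : 0 < e -> \forall x \near F, f x \is a fin_num.
  move=> e0; near=> x; rewrite ge0_fin_numE//.
  by apply: (@le_lt_trans _ _ e%:E); [near: x; exact: fe|exact: ltry].
(* Convergence to a finite limit in [\bar R] includes eventual finiteness, which the bound by 1
   supplies. *)
apply/fine_cvgP; split; first exact: (ffin 1 ltr01).
apply/cvgr0Pnorm_le => e e0; near=> x.
have fx : f x \is a fin_num by near: x; exact: (ffin 1 ltr01).
rewrite /= ger0_norm ?fine_ge0// -lee_fin fineK//.
by near: x; exact: fe.
Unshelve. all: by end_near. Qed.

Lemma ge0_le_poweR (R : realType) (s : R) (x y : \bar R) : 0 <= s ->
  (0 <= x)%E -> (x <= y)%E -> (x `^ s <= y `^ s)%E.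
Proof.
move=> s0 x0 xy; apply: gt0_ler_poweR => //; rewrite in_itv/= leey andbT//.
exact: le_trans xy.
Qed.

Lemma measurable_superlevel d (T : measurableType d) (R : realType)
    (f : T -> R) (l : R) : measurable_fun setT f ->
  measurable [set x | l < `|f x|].
Proof.
move=> mf; rewrite (_ : [set _ | _] = (Num.norm \o f) @^-1` `]l, +oo[%classic).
  by rewrite -[X in measurable X]setTI; exact: measurableT_comp.
by apply/seteqP; split => x /=; rewrite in_itv/= andbT.
Qed.

Lemma markov_superlevel d (T : measurableType d) (R : realType)
    (nu : {measure set T -> \bar R}) (f : T -> R) (l : R) :
  measurable_fun setT f -> 0 < l ->
  (l%:E * nu [set x | (l < `|f x|)%R] <= \int[nu]_x (`|f x|)%:E)%E.
Proof.
move=> mf l0; have mef : measurable_fun setT (EFin \o f) by exact/measurable_EFinP.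
(* This form of Markov's inequality concerns the set where [l <= |f|], which contains the strict
   superlevel set. *)
apply: le_trans (le_integral_abse nu measurableT mef l0).
apply: lee_pmul => //; first by rewrite lee_fin ltW.
apply: le_measure; rewrite ?inE; first exact: measurable_superlevel.
  rewrite setTI (_ : [set x | _] = (Num.norm \o f) @^-1` `[l, +oo[%classic).
    by rewrite -[X in measurable X]setTI; exact: measurableT_comp.
  by apply/seteqP; split => x /=; rewrite in_itv/= andbT lee_fin.
by move=> x /= /ltW lx; split => //; rewrite lee_fin.
Qed.

(** * Boxes and cubes as generators of the Borel sets of R^n *)

Section euclidean.
Context {R : realType} {n : nat}.
Local Notation Rn := (n.-tuple R).

Lemma tnth_vsub (x y : Rn) i : tnth (vsub x y) i = tnth x i - tnth y i.
Proof. by rewrite tnth_mktuple. Qed.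

Lemma measurable_vsub :
  measurable_fun [set: Rn * Rn] (fun p : Rn * Rn => vsub p.1 p.2).
Proof.
apply/measurable_fun_tnthP => i.
rewrite (_ : _ \o _ = (fun p : Rn * Rn => tnth p.1 i - tnth p.2 i)); last first.
  by apply/funext => p /=; rewrite tnth_vsub.
by apply: measurable_funB; apply: measurableT_comp (measurable_tnth i) _.
Qed.

Lemma measurable_vsubl (y : Rn) : measurable_fun [set: Rn] (vsub^~ y).
Proof.
have /(measurableT_comp measurable_vsub) := measurable_fun_pair
  (@measurable_id _ Rn setT) (measurable_cst (y : Rn)).
exact.
Qed.

Definition box (a b : Rn) : set Rn :=
  [set x | forall i, tnth a i <= tnth x i <= tnth b i].

(** Crossed corners are allowed, which keeps the family closed under intersection. *)
Definition boxes : set (set Rn) := [set A | exists a b, A = box a b].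

Definition cube (r : R) : set Rn := box [tuple - r | i < n] [tuple r | i < n].

Lemma cubeE r : cube r = [set x | forall i, `|tnth x i| <= r].
Proof.
by apply/seteqP; split => x /= + i => /(_ i); rewrite !tnth_mktuple ler_norml.
Qed.

Lemma measurable_box a b : measurable (box a b).
Proof.
rewrite (_ : box a b = \bigcap_(i in [set: 'I_n])
    ((@tnth n R)^~ i @^-1` `[tnth a i, tnth b i]%classic)).
  apply: fin_bigcap_measurable => // i _.
  by rewrite -[X in measurable X]setTI; exact: measurable_tnth.
apply/seteqP; split => x /=.
- by move=> h i _ /=; rewrite in_itv/=.
- by move=> h i; have := h i I; rewrite /= in_itv.
Qed.

Lemma measurable_cube r : measurable (cube r).
Proof. exact: measurable_box. Qed.

Lemma setI_closed_boxes : setI_closed boxes.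
Proof.
move=> _ _ [a [b ->]] [c [d ->]].
exists [tuple Num.max (tnth a i) (tnth c i) | i < n].
exists [tuple Num.min (tnth b i) (tnth d i) | i < n].
apply/seteqP; split => x /=.
- move=> [h1 h2] i; rewrite !tnth_mktuple ge_max le_min.
  by have /andP[-> ->] := h1 i; have /andP[-> ->] := h2 i.
- move=> h; split => i; have := h i;
    by rewrite !tnth_mktuple ge_max le_min => /andP[/andP[? ?] /andP[? ?]];
    apply/andP.
Qed.

Lemma cube_cover (x : Rn) : exists N, forall k : nat, (N <= k)%N -> cube k%:R x.
Proof.
exists (\max_(i < n) Num.bound `|tnth x i|) => k Nk; rewrite cubeE/= => i.
have /ltW/le_trans -> // := archi_boundP (normr_ge0 (tnth x i)).
by rewrite ler_nat (leq_trans _ Nk)// (leq_bigmax (F := fun i => Num.bound `|tnth x i|)).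
Qed.

Lemma bigcup_cube : \bigcup_k cube k%:R = [set: Rn].
Proof.
apply/seteqP; split => // x _; have [N h] := cube_cover x.
by exists N => //; exact: h.
Qed.

Lemma subset_cube r s : r <= s -> cube r `<=` cube s.
Proof. by rewrite !cubeE => rs x /= h i; rewrite (le_trans (h i)). Qed.

(** The product sigma-algebra is generated by coordinate preimages of Borel sets, and these in turn
    by closed half-spaces, so it suffices to build half-spaces from boxes. *)
Lemma measurable_boxesE : @measurable _ Rn = <<s boxes >>.
Proof.
apply/seteqP; split; last first.
  apply: smallest_sub; first exact: sigma_algebra_measurable.
  by move=> _ [a [b ->]]; exact: measurable_box.
apply: smallest_sub; first exact: smallest_sigma_algebra.
rewrite -bigcup_seq/= => _ [i _ [B mB <-]].
suff : measurable `<=` image_set_system setT ((@tnth n R)^~ i) <<s boxes >>.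
  exact.
rewrite [X in X `<=` _](RGenCInfty.measurableE R); apply: smallest_sub.
  exact/sigma_algebra_image/smallest_sigma_algebra.
move=> _ [r ->]; rewrite /image_set_system/= setTI.
(* The half-space [r <= tnth x i] is exhausted by boxes whose i-th lower face stays at [r] while all
   other faces recede to infinity. *)
rewrite (_ : _ @^-1` _ = \bigcup_k box
    [tuple if j == i then r else - k%:R | j < n] [tuple k%:R | j < n]).
  by apply: sigma_algebra_bigcup => k; apply: sub_gen_smallest; do 2 eexists.
apply/seteqP; split => x /=; rewrite ?in_itv/= ?andbT.
- move=> rx; have [N h] := cube_cover x; exists N => // j.
  have := h _ (leqnn N) j; rewrite !tnth_mktuple => /andP[h1 ->].
  by case: eqP => [->|]; rewrite ?rx ?h1.
- by move=> [k _ /(_ i)]; rewrite !tnth_mktuple eqxx => /andP[].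
Qed.

End euclidean.

(** * Translation invariance and sigma-finiteness of Lebesgue measure *)

Section lebesgue.
Context {R : realType} {n : nat}.
Local Notation Rn := (n.-tuple R).
Variable mu : {measure set Rn -> \bar R}.
Hypothesis mu_leb : is_lebesgue_measure mu.

(** Extends the volume formula, given only for ordered corners, to every member of the pi-system
    [boxes]: crossed corners give the empty set. *)
Lemma mu_box (a b : Rn) : mu (box a b) =
  (if [forall i, tnth a i <= tnth b i]
   then \prod_(i < n) (tnth b i - tnth a i) else 0)%:E.
Proof.
case: ifPn => [/forallP|/forallPn[i ab]]; first exact: mu_leb.
rewrite (_ : box a b = set0) ?measure0//.
apply/seteqP; split => // x /(_ i) /andP[ax xb].
by rewrite (le_trans ax xb) in ab.
Qed.

Lemma mu_box_lty (a b : Rn) : (mu (box a b) < +oo)%E.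
Proof. by rewrite mu_box ltry. Qed.

(** Uniqueness of measures: [mu] and its pushforward under translation agree on the generating
    pi-system of boxes, and the cubes exhaust R^n with finite measure. *)
Lemma mu_translate (y : Rn) (A : set Rn) : measurable A ->
  mu (vsub^~ y @^-1` A) = mu A.
Proof.
move=> mA; apply/esym.
pose m2 : {measure set Rn -> \bar R} :=
  measure_function_pushforward__canonical__measure_function_Measure mu
    (measurable_vsubl y).
apply: (measure_unique boxes (fun k => cube k%:R) _ _ _ _ mu m2) => //.
- exact: measurable_boxesE.
- exact: setI_closed_boxes.
- by move=> k; do 2 eexists.
- exact: bigcup_cube.
- move=> _ [a [b ->]]; rewrite /m2/= /pushforward.
  rewrite (_ : vsub^~ y @^-1` box a b = box [tuple tnth a i + tnth y i | i < n]
                                            [tuple tnth b i + tnth y i | i < n]).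
    rewrite !mu_box; congr (_%:E).
    under [in RHS]eq_forallb do rewrite !tnth_mktuple lerD2r.
    by case: ifP => // _; apply: eq_bigr => i _; rewrite !tnth_mktuple; ring.
  by apply/seteqP; split => x /= + i => /(_ i);
    rewrite !tnth_mktuple lerBrDr lerBlDr.
- by move=> k; exact: mu_box_lty.
Qed.

Lemma ge0_integral_translate (y : Rn) (f : Rn -> \bar R) :
  measurable_fun setT f -> (forall x, 0 <= f x)%E ->
  (\int[mu]_x f (vsub x y) = \int[mu]_x f x)%E.
Proof.
move=> mf f0.
rewrite [RHS](eq_measure_integral
  (measure_function_pushforward__canonical__measure_function_Measure mu
    (measurable_vsubl y))); last first.
  by move=> A mA _; rewrite /= /pushforward mu_translate.
by rewrite (ge0_integral_pushforward (measurable_vsubl y)).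
Qed.

Lemma lebesgue_sigma_finite : sigma_finite setT mu.
Proof.
exists (fun k => cube k%:R); first by rewrite bigcup_cube.
by move=> k; split; [exact: measurable_cube|exact: mu_box_lty].
Qed.

End lebesgue.

(** * Continuity of translation in L^1, from boxes to indicators to integrable functions *)

Section translation_continuity.
Context {R : realType} {n : nat}.
Local Notation Rn := (n.-tuple R).
Variable mu : {measure set Rn -> \bar R}.
Hypothesis mu_leb : is_lebesgue_measure mu.

(** The function w of the overview. *)
Definition translation_modulus (f : Rn -> R) (y : Rn) : \bar R :=
  (\int[mu]_x (`|f (vsub x y) - f x|)%:E)%E.

(** Measurability is bundled in so that integrals of increments can be compared and split in the
    closure lemmas below. *)
Definition translation_continuous (f : Rn -> R) :=
  measurable_fun setT f /\
  forall e : R, 0 < e -> exists2 d : R, 0 < d &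
    forall y, cube d y -> (translation_modulus f y <= e%:E)%E.

Local Notation tcont := translation_continuous.

Lemma measurable_translate (f : Rn -> R) (y : Rn) :
  measurable_fun setT f -> measurable_fun setT (fun x => f (vsub x y)).
Proof. by move=> mf; exact: measurableT_comp mf (measurable_vsubl y). Qed.

Lemma measurable_increment (f : Rn -> R) (y : Rn) : measurable_fun setT f ->
  measurable_fun setT (fun x => (`|f (vsub x y) - f x|)%:E).
Proof.
move=> mf; apply/measurable_EFinP; apply: measurableT_comp => //.
by apply: measurable_funB => //; exact: measurable_translate.
Qed.

Lemma translation_modulus_ge0 f y : (0 <= translation_modulus f y)%E.
Proof. by apply: integral_ge0 => x _; rewrite lee_fin. Qed.

(** Triangle inequality, after which translation invariance of [mu] identifies the shifted norm with
    the unshifted one. *)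
Lemma translation_modulus_le (f : Rn -> R) y : measurable_fun setT f ->
  (translation_modulus f y <= L1norm mu f + L1norm mu f)%E.
Proof.
move=> mf; have mnf : measurable_fun setT (fun x => (`|f x|)%:E).
  by apply/measurable_EFinP; exact: measurableT_comp.
have mnfy : measurable_fun setT (fun x => (`|f (vsub x y)|)%:E).
  by apply/measurable_EFinP; apply: measurableT_comp => //; exact: measurable_translate.
rewrite /L1norm -[X in (X + _)%E](ge0_integral_translate mu_leb y)//.
rewrite -ge0_integralD//.
apply: ge0_le_integral => //.
- exact: measurable_increment.
- exact: emeasurable_funD.
- by move=> x _; rewrite -EFinD lee_fin ler_normB.
Qed.

Lemma translation_continuous_cst c : tcont (cst c).
Proof.
split; first exact: measurable_cst.
move=> e e0; exists 1 => // y _; rewrite /translation_modulus.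
under eq_integral do rewrite /= subrr normr0.
by rewrite integral0 lee_fin ltW.
Qed.

Lemma translation_continuous_lin c f h :
  tcont f -> tcont h -> tcont (fun x => c * f x + h x).
Proof.
move=> [mf tf] [mh th]; split.
  by apply: measurable_funD => //; exact: measurable_funM.
move=> e e0.
(* Dividing by [|c| + 1] rather than [|c|] covers [c = 0]. *)
have c0 : 0 < `|c| + 1 by rewrite ltr_wpDl.
have [d1 d10 h1] := tf (e / 2 / (`|c| + 1)) ltac:(by rewrite !divr_gt0).
have [d2 d20 h2] := th (e / 2) ltac:(by rewrite divr_gt0).
exists (Num.min d1 d2); first by rewrite lt_min d10.
move=> y yd.
have {}h1 : (translation_modulus f y <= (e / 2 / (`|c| + 1))%:E)%E.
  by apply: h1; apply: subset_cube yd; rewrite ge_min lexx.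
have {}h2 : (translation_modulus h y <= (e / 2)%:E)%E.
  by apply: h2; apply: subset_cube yd; rewrite ge_min lexx orbT.
apply: (@le_trans _ _ (`|c|%:E * translation_modulus f y
                       + translation_modulus h y)%E).
  rewrite /translation_modulus -ge0_integralZl_EFin//; last exact: measurable_increment.
  rewrite -ge0_integralD//; first last.
  - exact: measurable_increment.
  - by apply: measurable_funeM; exact: measurable_increment.
  apply: ge0_le_integral => //.
  - apply: measurable_increment.
    by apply: measurable_funD => //; exact: measurable_funM.
  - apply: emeasurable_funD; last exact: measurable_increment.
    by apply: measurable_funeM; exact: measurable_increment.
  - move=> x _; rewrite -EFinM -EFinD lee_fin -normrM.
    rewrite (_ : _ - _ = c * (f (vsub x y) - f x) + (h (vsub x y) - h x)).
      exact: ler_normD.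
    by ring.
rewrite [e]splitr EFinD; apply: leeD => //.
apply: le_trans (lee_wpmul2l _ h1) _; first by rewrite lee_fin.
rewrite -EFinM lee_fin mulrCA -[leRHS]mulr1 ler_wpM2l// ?divr_ge0 ?ltW//.
by rewrite ltr_pdivrMr// mul1r ltrDl.
Qed.

(** The hypothesis bears on the products [c i * f i], so that a zero coefficient may accompany the
    indicator of a set of infinite measure. *)
Lemma translation_continuous_sum (I : eqType) (s : seq I) (c : I -> R)
    (f : I -> Rn -> R) : (forall i, i \in s -> tcont (fun x => c i * f i x)) ->
  tcont (fun x => \sum_(i <- s) c i * f i x).
Proof.
elim: s => [_|i s ih h].
  by under eq_fun do rewrite big_nil; exact: translation_continuous_cst.
under eq_fun do rewrite big_cons -[c i * _]mul1r.
apply: translation_continuous_lin; first by apply: h; rewrite mem_head.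
by apply: ih => j js; apply: h; rewrite inE js orbT.
Qed.

(** An e/3 argument: the modulus of [g] is at most that of [g - h] plus that of [h], and the former
    is at most twice the L^1 norm of [g - h], uniformly in the translation. *)
Lemma translation_continuous_L1_closed (g : Rn -> R) : measurable_fun setT g ->
  (forall e : R, 0 < e -> exists2 h, tcont h &
     (L1norm mu (fun x => g x - h x)%R <= e%:E)%E) ->
  tcont g.
Proof.
move=> mg gh; split => // e e0.
have [h [mh th] ghe] := gh (e / 3) ltac:(by rewrite divr_gt0).
have [d d0 hd] := th (e / 3) ltac:(by rewrite divr_gt0).
exists d => // y /hd {}hd.
have mgh : measurable_fun setT (fun x => g x - h x) by exact: measurable_funB.
apply: (@le_trans _ _ (translation_modulus (fun x => g x - h x)%R y
                       + translation_modulus h y)%E).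
  rewrite /translation_modulus -ge0_integralD//; try exact: measurable_increment.
  apply: ge0_le_integral => //; first exact: measurable_increment.
    by apply: emeasurable_funD; exact: measurable_increment.
  move=> x _; rewrite -EFinD lee_fin.
  have -> : g (vsub x y) - g x =
      g (vsub x y) - h (vsub x y) - (g x - h x) + (h (vsub x y) - h x) by ring.
  exact: ler_normD.
rewrite (_ : e = e / 3 + e / 3 + e / 3); last by field.
rewrite !EFinD leeD//.
exact: le_trans (translation_modulus_le _ mgh) (leeD _ _).
Qed.

Lemma translation_continuous_box a b : tcont (\1_(box a b) : Rn -> R).
Proof.
have [/forallP/= ab|/forallPn[i iab]] :=
    boolP [forall i, tnth a i <= tnth b i]; last first.
  rewrite (_ : box a b = set0) ?indic0; first exact: translation_continuous_cst.
  apply/seteqP; split => // x /(_ i) /andP[ax xb].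
  by rewrite (le_trans ax xb) in iab.
split; first by apply: measurable_indic; exact: measurable_box.
move=> e e0.
(* Both the box and its translate lie in the box enlarged by [d], whose volume
   [p.[d]] tends to the volume [p.[0]] of the box. *)
pose p : {poly R} :=
  \prod_(i < n) ((tnth b i - tnth a i)%:P + 2%:P * 'X).
have pE t : p.[t] = \prod_(i < n) (tnth b i - tnth a i + 2 * t).
  by rewrite horner_prod; apply: eq_bigr => i _; rewrite !hornerE.
have [d d0 pd] : exists2 d, 0 < d & p.[d] - p.[0] < e / 2.
  have /cvgrPdist_lt/(_ (e / 2)) := @continuous_horner R p 0.
  rewrite divr_gt0// => /(_ isT) /nbhs_ballP[d /= d0 hd].
  exists (d / 2); first by rewrite divr_gt0.
  have : ball 0 d (d / 2).
    by rewrite /ball/= sub0r normrN gtr0_norm ?divr_gt0// gtr_pMr// invf_lt1// ltr1n.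
  by move/hd; rewrite distrC; exact/le_lt_trans/ler_norm.
exists d => // y; rewrite cubeE/= => yd.
pose B' := box [tuple tnth a i - d | i < n] [tuple tnth b i + d | i < n].
have mB : measurable (box a b) := measurable_box a b.
have mB' : measurable B' by exact: measurable_box.
have mBy : measurable (vsub^~ y @^-1` box a b).
  by rewrite -[X in measurable X]setTI; exact: measurable_vsubl.
have muB : mu (box a b) = p.[0]%:E.
  rewrite mu_leb// pE; congr (_%:E).
  by apply: eq_bigr => i _; rewrite mulr0 addr0.
have muB' : mu B' = p.[d]%:E.
  rewrite mu_leb; last first.
    by move=> i; rewrite !tnth_mktuple; have := ab i; lra.
  by rewrite pE; congr (_%:E); apply: eq_bigr => i _; rewrite !tnth_mktuple; ring.
have BB' : box a b `<=` B'.
  by move=> x /= + i => /(_ i); rewrite !tnth_mktuple; lra.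
have ByB' : vsub^~ y @^-1` box a b `<=` B'.
  move=> x /= + i => /(_ i); rewrite !tnth_mktuple.
  by have := yd i; rewrite ler_norml; lra.
have diffE A : measurable A -> A `<=` B' -> mu A = p.[0]%:E ->
    mu (B' `\` A) = (p.[d] - p.[0])%:E.
  move=> mA AB muA; transitivity (mu B' - mu A)%E; last by rewrite muB' muA.
  rewrite -[in RHS](setIidr AB); apply: measureD => //.
  by rewrite [X in (X < _)%E]muB' ltry.
(* Where the two indicators differ, the point lies in [B'] and misses one of the two boxes; each of
   these remainders has measure [p.[d] - p.[0]]. *)
apply: (@le_trans _ _ (mu (B' `\` (vsub^~ y @^-1` box a b)) + mu (B' `\` box a b))%E).
  have mD1 : measurable (B' `\` (vsub^~ y @^-1` box a b)) by exact: measurableD.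
  have mD2 : measurable (B' `\` box a b) by exact: measurableD.
  have intE A : measurable A -> mu A = (\int[mu]_x (\1_A x)%:E)%E.
    by move=> mA; rewrite integral_indic// setIT.
  rewrite (intE _ mD1) (intE _ mD2) -ge0_integralD//;
    try by apply/measurable_EFinP; exact: measurable_indic.
  apply: ge0_le_integral => //.
  - by apply: measurable_increment; exact: measurable_indic.
  - by apply: emeasurable_funD; apply/measurable_EFinP; exact: measurable_indic.
  move=> x _; rewrite -EFinD lee_fin !indicE !in_setD.
  rewrite (_ : (x \in vsub^~ y @^-1` box a b) = (vsub x y \in box a b))//.
  have : (vsub x y \in box a b) ==> (x \in B').
    by apply/implyP => /set_mem/ByB'/mem_set.
  have : (x \in box a b) ==> (x \in B') by apply/implyP => /set_mem/BB'/mem_set.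
  by case: (x \in box a b); case: (vsub x y \in box a b); case: (x \in B') => //= _ _;
    rewrite ?subrr ?subr0 ?sub0r ?normrN ?normr0 ?normr1 ?add0r ?addr0.
rewrite !diffE//; last by rewrite mu_translate.
by rewrite -EFinD lee_fin; lra.
Qed.

Lemma L1norm_indicB (A B : set Rn) : measurable A -> measurable B ->
  B `<=` A -> L1norm mu (fun x => \1_A x - \1_B x)%R = mu (A `\` B).
Proof.
move=> mA mB BA; rewrite -(setIT (A `\` B)).
rewrite -integral_indic//; last exact: measurableD.
apply: eq_integral => x _; congr (_%:E); rewrite !indicE in_setD.
have : (x \in B) ==> (x \in A) by apply/implyP => /set_mem/BA/mem_set.
by case: (x \in A); case: (x \in B) => //= _;
  rewrite ?subrr ?subr0 ?normr0 ?normr1.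
Qed.

(** The indicators of [F k] converge in L^1 to that of the union: the distance is the measure of the
    remainder, which tends to 0 because the union has finite measure. *)
Lemma translation_continuous_bigcup (F : (set Rn)^nat) :
  (forall k, measurable (F k)) -> nondecreasing_seq F ->
  (mu (\bigcup_k F k) < +oo)%E -> (forall k, tcont (\1_(F k) : Rn -> R)) ->
  tcont (\1_(\bigcup_k F k) : Rn -> R).
Proof.
move=> mF ndF Foo tF.
have mUF : measurable (\bigcup_k F k) by exact: bigcup_measurable.
have mD k : measurable (\bigcup_k F k `\` F k) by exact: measurableD.
apply: translation_continuous_L1_closed; first exact: measurable_indic.
move=> e e0.
have [k /ltW ek] : exists k, (mu (\bigcup_k F k `\` F k) < e%:E)%E.
  apply: nonincreasing_measure_lt => //.
  - apply: le_lt_trans Foo; apply: le_measure; rewrite ?inE//.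
  - move=> i j ij; apply/subsetPset; apply: setDS.
    exact/subsetPset/ndF.
  - apply/seteqP; split => // x /= h; have [[i _ Fix] _] := h 0%N I.
    by have [_] := h i I.
exists (\1_(F k)) => //; rewrite L1norm_indicB//.
exact: bigcup_sup.
Qed.

(** A Dynkin argument starting from the pi-system of boxes handles every truncation of [A] to a
    cube; [A] itself is the increasing union of these truncations and has finite measure. *)
Lemma translation_continuous_indic (A : set Rn) : measurable A ->
  (mu A < +oo)%E -> tcont (\1_A : Rn -> R).
Proof.
move=> mA Aoo.
have ndI B : nondecreasing_seq (fun k => B `&` (cube k%:R : set Rn)).
  move=> i j ij; apply/subsetPset; apply: setIS.
  by apply: subset_cube; rewrite ler_nat.
have mI B k : measurable B -> measurable (B `&` (cube k%:R : set Rn)).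
  by move=> mB; apply: measurableI => //; exact: measurable_cube.
(* Truncating to cubes puts the whole space in [H] and makes the unions finite in measure, so that
   [H] is a lambda-system. *)
pose H : set (set Rn) := [set B | measurable B /\
  forall k : nat, tcont (\1_(B `&` cube k%:R) : Rn -> R)].
suff /(_ _ mA)[_ tA] : measurable `<=` H.
  rewrite -[A]setIT -bigcup_cube setI_bigcupr.
  apply: translation_continuous_bigcup => //.
  - by move=> k; exact: mI.
  - by rewrite -setI_bigcupr bigcup_cube setIT.
rewrite measurable_boxesE; apply: lambda_system_subset => //.
- exact: setI_closed_boxes.
- split => //.
  + split; first exact: measurableT.
    by move=> k; rewrite setTI; exact: translation_continuous_box.
  + move=> B C CB [mB tB] [mC tC]; split; first exact: measurableD.
    move=> k; rewrite (_ : \1_ _ = (fun x => -1 * \1_(C `&` cube k%:R) x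
                                             + \1_(B `&` cube k%:R) x)).
      exact: translation_continuous_lin.
    apply/funext => x; rewrite !indicE in_setI in_setD !in_setI.
    have : (x \in C) ==> (x \in B) by apply/implyP => /set_mem/CB/mem_set.
    by case: (x \in B); case: (x \in C); case: (x \in cube _) => //= _; ring.
  + move=> F ndF HF; split; first by apply: bigcup_measurable => k _; apply HF.
    move=> k; rewrite setI_bigcupl; apply: translation_continuous_bigcup.
    * by move=> i; apply: mI; apply HF.
    * by move=> i j ij; apply/subsetPset; apply: setSI; apply/subsetPset/ndF.
    * have : (mu (cube k%:R) < +oo)%E by exact: mu_box_lty.
      apply: le_lt_trans; apply: le_measure.
      - by rewrite inE; apply: bigcup_measurable => i _; apply: mI; apply HF.
      - by rewrite inE; exact: measurable_cube.
      - by apply: bigcup_sub => i _ x [].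
    * by move=> i; apply HF.
- move=> _ [a [b ->]]; split; first exact: measurable_box.
  move=> k; have [c [d ->]] : boxes (box a b `&` cube k%:R).
    by apply: setI_closed_boxes; do 2 eexists.
  exact: translation_continuous_box.
Qed.

Import HBSimple.

(** Integrable simple functions are dense in L^1, and each is a finite combination of indicators of
    its level sets. *)
Lemma translation_continuous_inL1 (g : Rn -> R) : inL1 mu g -> tcont g.
Proof.
move=> [mg ig]; apply: translation_continuous_L1_closed => // e e0.
have [h [ih _]] := approximation_sfun_integrable measurableT ig.
move=> /fine_cvgP[hfin /cvgr_lt/(_ e e0) he].
have [k kfin ke] : exists2 k,
    (\int[mu]_z `|(EFin \o g) z - (h k z)%:E|)%E \is a fin_num &
    fine (\int[mu]_z `|(EFin \o g) z - (h k z)%:E|)%E < e.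
  near \oo => k; exists k; first by near: k; exact: hfin.
  by near: k; exact: he.
exists (h k); last by move: ke; rewrite -lte_fin fineK// => /ltW.
have -> : (h k : Rn -> R) = (fun x =>
    \sum_(y <- finmap.enum_fset (fset_set (range (h k)))) y * \1_(h k @^-1` [set y]) x).
  by apply/funext => x; rewrite fimfunE fsbig_finite.
apply: translation_continuous_sum => y _.
(* The level set of 0 may have infinite measure, but its term in the sum vanishes. *)
have [->|y0] := eqVneq y 0.
  under eq_fun do rewrite mul0r; exact: translation_continuous_cst.
under eq_fun do rewrite -[y * _]addr0.
apply: (@translation_continuous_lin y _ (cst 0)); last exact: translation_continuous_cst.
have my : measurable (h k @^-1` [set y]).
  by apply: measurable_funPTI; exact: measurable_set1.
apply: translation_continuous_indic => //.
have [mh hoo] := integrableP _ _ _ (ih k).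
(* The level set of [y] lies strictly above level [|y| / 2], so Markov's inequality shows that its
   measure is finite. *)
have y2 : 0 < `|y| / 2 by rewrite divr_gt0// normr_gt0.
apply: (@le_lt_trans _ _ (mu [set x | (`|y| / 2 < `|h k x|)%R])).
  apply: le_measure; rewrite ?inE//; first exact: measurable_superlevel.
  by move=> x /= ->; rewrite ltr_pdivrMr// ltr_pMr ?normr_gt0// ltr1n.
rewrite -(@lte_pmul2l _ (`|y| / 2)%:E) ?lte_fin// gt0_muley ?lte_fin//.
exact: le_lt_trans (markov_superlevel _ _ y2) hoo.
Unshelve. all: by end_near. Qed.

End translation_continuity.

(* A copy of [nu] that can carry the sigma-finite structure required by Tonelli's
   theorem. *)
Definition msigma_finite d (T : measurableType d) (R : realType)
  (nu : set T -> \bar R) & sigma_finite setT nu : set T -> \bar R := nu.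

Section sigma_finite_copy.
Context d (T : measurableType d) (R : realType).
Variable nu : {measure set T -> \bar R}.
Hypothesis nu_sf : sigma_finite setT nu.

Local Notation nu' := (msigma_finite nu_sf).

HB.instance Definition _ := Measure.on nu'.

HB.instance Definition _ := Measure_isSigmaFinite.Build _ _ _ nu' nu_sf.

End sigma_finite_copy.

(** * Measurability of convolutions and their pointwise deviation from a multiple of [g] *)

Section convolution.
Context {R : realType} {n : nat}.
Local Notation Rn := (n.-tuple R).

Lemma measurable_convolution_integrand (g f : Rn -> R) :
  measurable_fun setT g -> measurable_fun setT f ->
  measurable_fun setT (fun p : Rn * Rn => (g (vsub p.1 p.2) * f p.2)%:E).
Proof.
move=> mg mf; apply/measurable_EFinP; apply: measurable_funM.
  exact: measurableT_comp mg measurable_vsub.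
exact: measurableT_comp mf measurable_snd.
Qed.

(* [Defs.conv] is qualified because MathComp-Analysis has a [conv] for convex
   combinations. *)
Lemma measurable_conv (nu : {sigma_finite_measure set Rn -> \bar R})
    (g f : Rn -> R) : measurable_fun setT g -> measurable_fun setT f ->
  measurable_fun setT (Defs.conv nu g f).
Proof.
move=> mg mf; have mgf := measurable_convolution_integrand mg mf.
rewrite /Defs.conv /Rintegral; apply: (measurableT_comp (fine_measurable measurableT)).
pose F (p : Rn * Rn) := (g (vsub p.1 p.2) * f p.2)%:E.
(* Tonelli's measurability statement concerns nonnegative integrands, hence the split into positive
   and negative parts. *)
have -> : (fun x => \int[nu]_y (g (vsub x y) * f y)%:E)%E =
    (fubini_F nu F^\+ \- fubini_F nu F^\-)%E.
  apply/funext => x; rewrite integralE; congr (_ - _)%E; apply: eq_integral => y _.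
  - by rewrite !funeposE.
  - by rewrite !funenegE.
have mF : measurable_fun setT F by exact: mgf.
apply: emeasurable_funB; apply: measurable_fun_fubini_tonelli_F => //.
- exact: measurable_funepos.
- exact: measurable_funeneg.
Qed.

(* No integrability of [g (vsub x y)] in [y] is needed: when it fails, [conv] takes
   a junk value, but then the right-hand side is [+oo]. *)
Lemma conv_indic_increment (nu : {measure set Rn -> \bar R}) (g : Rn -> R)
    (D : set Rn) (x : Rn) :
  measurable_fun setT g -> measurable D -> (nu D < +oo)%E ->
  ((`|Defs.conv nu g \1_D x - g x * fine (nu D)|)%:E <=
   \int[nu]_y (`|g (vsub x y) - g x| * \1_D y)%:E)%E.
Proof.
move=> mg mD Doo.
have [->|] := eqVneq (\int[nu]_y (`|g (vsub x y) - g x| * \1_D y)%:E)%E +oo%E.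
  by rewrite leey.
rewrite -ltey => Ioo.
have mgx : measurable_fun setT (fun y => g (vsub x y)).
  have /(measurableT_comp measurable_vsub) := measurable_fun_pair
    (measurable_cst (x : Rn)) (@measurable_id _ Rn setT).
  exact: measurableT_comp.
have m1 : measurable_fun setT (\1_D : Rn -> R) by exact: measurable_indic.
pose k y := (g (vsub x y) - g x) * \1_D y.
have mk : measurable_fun setT k.
  by apply: measurable_funM => //; exact: measurable_funB.
have ik : nu.-integrable setT (EFin \o k).
  apply/integrableP; split; first exact/measurable_EFinP.
  apply: le_lt_trans Ioo; apply: ge0_le_integral => //.
  - by apply: measurableT_comp => //; exact/measurable_EFinP.
  - apply/measurable_EFinP; apply: measurable_funM => //.
    by apply: measurableT_comp => //; exact: measurable_funB.
  - by move=> y _; rewrite /= /k lee_fin normrM [`|\1_D y|]ger0_norm.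
have i1 : nu.-integrable setT (EFin \o (\1_D : Rn -> R)).
  apply/integrableP; split; first exact/measurable_EFinP.
  under eq_integral do rewrite /= ger0_norm//.
  by rewrite integral_indic// setIT.
have ic : nu.-integrable setT (EFin \o (fun y => g x * \1_D y)).
  exact: (integrableZl measurableT (g x) i1).
rewrite /Defs.conv.
(* Both summands are integrable, the first by finiteness of the right-hand side; the second
   integrates to exactly the subtracted term. *)
rewrite (_ : (fun y => g (vsub x y) * \1_D y) = (fun y => k y + g x * \1_D y));
  last by apply/funext => y; rewrite /k; ring.
rewrite RintegralD// RintegralZl// {2}/Rintegral integral_indic// setIT addrK.
rewrite EFin_normr_Rintegral//; apply: le_trans (le_abse_integral _ _ _) _ => //.
  exact/measurable_EFinP.
apply: ge0_le_integral => //.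
- by apply: measurableT_comp => //; exact/measurable_EFinP.
- apply/measurable_EFinP; apply: measurable_funM => //.
  by apply: measurableT_comp => //; exact: measurable_funB.
- by move=> y _; rewrite /= /k lee_fin normrM [`|\1_D y|]ger0_norm.
Qed.

End convolution.

(** * Deviation estimates in measure, then the limit and the weak-type bound *)

Section approximate_identity.
Context {R : realType} {n : nat}.
Local Notation Rn := (n.-tuple R).
Variable mu : {measure set Rn -> \bar R}.
Hypothesis mu_leb : is_lebesgue_measure mu.

Lemma measurable_increment2 (g : Rn -> R) (D : set Rn) :
  measurable_fun setT g -> measurable D ->
  measurable_fun setT (fun p : Rn * Rn =>
    (`|g (vsub p.1 p.2) - g p.1| * \1_D p.2)%:E).
Proof.
move=> mg mD; apply/measurable_EFinP; apply: measurable_funM.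
  apply: measurableT_comp => //; apply: measurable_funB.
    exact: measurableT_comp mg measurable_vsub.
  exact: measurableT_comp mg measurable_fst.
by apply: measurableT_comp measurable_snd; exact: measurable_indic.
Qed.

(** Integrate the pointwise bound in x and exchange the integrals by Tonelli; the inner integral
    becomes the translation modulus. The indicator lets one estimate serve both claims: [D = setT]
    with a dilate of [V], and [D = cube d] with [mu] itself. *)
Lemma integral_conv_indic_increment (nu : {measure set Rn -> \bar R})
    (g : Rn -> R) (D : set Rn) :
  sigma_finite setT nu -> measurable_fun setT g -> measurable D ->
  (nu D < +oo)%E ->
  (\int[mu]_x (`|Defs.conv nu g \1_D x - g x * fine (nu D)|)%:E <=
   \int[nu]_y (translation_modulus mu g y * (\1_D y)%:E))%E.
Proof.
move=> nu_sf mg mD Doo.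
have mu_sf := lebesgue_sigma_finite mu_leb.
have mF := measurable_increment2 mg mD.
have F0 (p : Rn * Rn) : (0 <= (`|g (vsub p.1 p.2) - g p.1| * \1_D p.2)%:E)%E.
  by rewrite lee_fin mulr_ge0.
have m1 : measurable_fun setT (\1_D : Rn -> R) by exact: measurable_indic.
have mconv := measurable_conv (msigma_finite nu_sf) mg m1.
have := fubini_tonelli (m1 := msigma_finite mu_sf) (m2 := msigma_finite nu_sf) _ mF F0.
rewrite /= => Fub.
apply: (@le_trans _ _
    (\int[mu]_x \int[nu]_y (`|g (vsub x y) - g x| * \1_D y)%:E)%E).
  apply: ge0_le_integral => //.
  - apply/measurable_EFinP; apply: measurableT_comp => //.
    apply: measurable_funB; first exact: mconv.
    exact: measurable_funM.
  - exact: (measurable_fun_fubini_tonelli_F (m2 := msigma_finite nu_sf) _ mF F0).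
  - by move=> x _; exact: conv_indic_increment.
rewrite [leLHS]Fub le_eqVlt; apply/orP; left; apply/eqP.
apply: eq_integral => y _; rewrite muleC /translation_modulus.
rewrite -ge0_integralZl_EFin//; last exact: measurable_increment.
by apply: eq_integral => x _; rewrite -EFinM mulrC.
Qed.

Lemma measurable_translation_modulus (g : Rn -> R) : measurable_fun setT g ->
  measurable_fun setT (translation_modulus mu g).
Proof.
move=> mg; have mu_sf := lebesgue_sigma_finite mu_leb.
have mF := measurable_increment2 mg measurableT.
have F0 (p : Rn * Rn) : (0 <= (`|g (vsub p.1 p.2) - g p.1| * \1_setT p.2)%:E)%E.
  by rewrite lee_fin mulr_ge0.
have := measurable_fun_fubini_tonelli_G (m1 := msigma_finite mu_sf) _ mF F0.
congr (measurable_fun _ _); apply/funext => y; apply: eq_integral => x _.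
by rewrite /= indicT mulr1.
Qed.

(** Markov's inequality reduces this to integrating the modulus over [D]: it is at most [e] inside
    [cube d] and at most twice the norm of [g] outside. *)
Lemma conv_indic_deviation (nu : {measure set Rn -> \bar R})
    (g : Rn -> R) (D : set Rn) (d e l : R) :
  sigma_finite setT nu -> inL1 mu g -> measurable D -> (nu D < +oo)%E ->
  0 <= e -> 0 < l ->
  (forall y, cube d y -> (translation_modulus mu g y <= e%:E)%E) ->
  (l%:E * mu [set x | (l < `|Defs.conv nu g \1_D x - g x * fine (nu D)|)%R] <=
   e%:E * nu D + (L1norm mu g + L1norm mu g) * nu (D `\` cube d))%E.
Proof.
move=> nu_sf [mg ig] mD Doo e0 l0 ge.
pose M := (L1norm mu g + L1norm mu g)%E.
have M0 : (0 <= M)%E by rewrite adde_ge0// integral_ge0.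
have m1 : measurable_fun setT (\1_D : Rn -> R) by exact: measurable_indic.
have mconv := measurable_conv (msigma_finite nu_sf) mg m1.
have mdev : measurable_fun setT
    (fun x => Defs.conv nu g \1_D x - g x * fine (nu D)).
  by apply: measurable_funB; [exact: mconv|exact: measurable_funM].
have mDd : measurable (D `\` cube d).
  by apply: measurableD => //; exact: measurable_cube.
have intD A : measurable A -> (\int[nu]_y (\1_A y)%:E)%E = nu A.
  by move=> mA; rewrite integral_indic// setIT.
apply: (@le_trans _ _
    (\int[mu]_x (`|Defs.conv nu g \1_D x - g x * fine (nu D)|)%:E)%E).
  exact: markov_superlevel.
apply: le_trans (integral_conv_indic_increment nu_sf mg mD Doo) _.
rewrite -!intD// -[(L1norm mu g + _)%E]/M.
rewrite -ge0_integralZl_EFin//; last exact/measurable_EFinP.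
rewrite -ge0_integralZl//; last first.
  by apply/measurable_EFinP; exact: measurable_indic.
have m2 : measurable_fun setT (\1_(D `\` cube d) : Rn -> R).
  exact: measurable_indic.
rewrite -ge0_integralD//; first last.
- by apply: emeasurable_funM => //; exact/measurable_EFinP.
- by move=> y _; rewrite mule_ge0.
- by apply: measurable_funeM; exact/measurable_EFinP.
- by move=> y _; rewrite mule_ge0.
apply: ge0_le_integral => //.
- by move=> y _; rewrite mule_ge0// translation_modulus_ge0.
- apply: emeasurable_funM; first exact: measurable_translation_modulus.
  exact/measurable_EFinP.
- apply: emeasurable_funD; first by apply: measurable_funeM; exact/measurable_EFinP.
  by apply: emeasurable_funM => //; exact/measurable_EFinP.
move=> y _; rewrite !indicE in_setD.
case: (y \in D); rewrite ?mule0 ?adde0//= !mule1.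
have [/set_mem yd|yd] := boolP (y \in cube d).
  by rewrite /= mule0 adde0 ge.
rewrite /= mule1; apply: le_trans (translation_modulus_le mu_leb _ mg) _.
by rewrite leeDr// lee_fin.
Qed.

Lemma conv_indicT (nu : {measure set Rn -> \bar R}) (g : Rn -> R) :
  Defs.conv nu g \1_setT = convm nu g.
Proof.
by apply/funext => x; rewrite /convm; apply: eq_Rintegral => y _;
  rewrite indicT mulr1.
Qed.

Lemma L1norm_fin_num (g : Rn -> R) : inL1 mu g -> L1norm mu g \is a fin_num.
Proof.
move=> [mg /integrableP[_ ioo]]; rewrite ge0_fin_numE//; exact: integral_ge0.
Qed.

Lemma convm_dilate_cvg_in_measure (V : {measure set Rn -> \bar R})
    (g : Rn -> R) (l : R) : (V setT < +oo)%E -> inL1 mu g -> 0 < l ->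
  mu [set x | l < `|convm (dilate V t) g x - g x * fine (V setT)|]
    @[t --> 0^'+] --> 0%E.
Proof.
move=> Voo ig l0; apply: ge0_cvge0 => // e e0.
have [mg tg] := translation_continuous_inL1 mu_leb ig.
have Vfin : V setT \is a fin_num by rewrite ge0_fin_numE.
have gfin := L1norm_fin_num ig.
pose v := fine (V setT); pose m := fine (L1norm mu g).
have v0 : 0 <= v by rewrite fine_ge0.
have m0 : 0 <= m by rewrite fine_ge0// integral_ge0.
(* The deviation estimate bounds [l] times the measure, so the target is [l * e], half for each of
   its two terms. Adding 1 to [v], and below to [2 * m], keeps the denominators positive. *)
have e'0 : 0 < l * e / 2 / (v + 1) by rewrite !divr_gt0 ?mulr_gt0 ?ltr_wpDl.
have [d d0 hd] := tg _ e'0.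
have [k Vk] : exists k : nat,
    (V (~` cube k%:R) < (l * e / 2 / (2 * m + 1))%:E)%E.
  apply: (nonincreasing_measure_lt (G := fun k => ~` cube k%:R)).
  - by apply: le_lt_trans Voo; apply: le_measure;
      rewrite ?inE//; apply: measurableC; exact: measurable_cube.
  - by move=> k; apply: measurableC; exact: measurable_cube.
  - move=> i j ij; apply/subsetPset; apply: subsetC.
    by apply: subset_cube; rewrite ler_nat.
  - by rewrite -setC_bigcup bigcup_cube setCT.
  - by rewrite !divr_gt0 ?mulr_gt0 ?ltr_wpDl// mulr_ge0.
near=> t.
have t0 : 0 < t by near: t; exact: nbhs_right_gt.
(* For such [t], [vscale t] maps [cube k%:R] into [cube d], so the dilate's mass outside [cube d] is
   at most the mass of [V] outside [cube k%:R]. The successor avoids dividing by zero when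
   [k = 0]. *)
have td : t <= d / k.+1%:R by near: t; apply: nbhs_right_le; rewrite divr_gt0.
have sf : sigma_finite setT (dilate V t).
  by exists (fun=> setT); [rewrite bigcup_const|move=> _; split].
have := conv_indic_deviation sf ig measurableT Voo
  (ltW e'0) l0 hd.
rewrite conv_indicT => /le_trans h.
rewrite -(@lee_pmul2l _ l%:E)// ?lte_fin//; apply: h.
rewrite [X in (_ * X + _)%E](_ : _ = v%:E); last by rewrite -[LHS]/(V setT) fineK.
have Vd : (dilate V t (setT `\` cube d) <= (l * e / 2 / (2 * m + 1))%:E)%E.
  apply: le_trans (ltW Vk).
  rewrite -[leLHS]/(V (vscale t @^-1` (setT `\` cube d))).
  apply: le_measure; rewrite ?inE.
  - rewrite -[X in measurable X]setTI; apply: measurable_vscale => //.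
    by apply: measurableD => //; exact: measurable_cube.
  - by apply: measurableC; exact: measurable_cube.
  - move=> y /= [_]; apply: contra_not => yk; rewrite cubeE/= => i.
    rewrite tnth_mktuple normrM gtr0_norm//.
    move: yk; rewrite cubeE => /(_ i) /= yk.
    have {}yk : `|tnth y i| <= k.+1%:R by rewrite (le_trans yk)// ler_nat.
    apply: (@le_trans _ _ (d / k.+1%:R * k.+1%:R)); last by rewrite divfK.
    by apply: ler_pM => //; exact: ltW.
apply: le_trans (leeD2l _ (lee_wpmul2l _ Vd)) _.
  by rewrite adde_ge0// integral_ge0.
rewrite -(fineK gfin) -/m -!EFinD -!EFinM lee_fin.
rewrite -/v.
have h1 : l * e / 2 / (v + 1) * v <= l * e / 2.
  rewrite -mulrA ger_pMr ?divr_gt0 ?mulr_gt0// mulrC ler_pdivrMr ?ltr_wpDl//.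
  by rewrite mul1r lerDl.
have h2 : (m + m) * (l * e / 2 / (2 * m + 1)) <= l * e / 2.
  rewrite mulrCA ger_pMr ?divr_gt0 ?mulr_gt0//.
  by rewrite ler_pdivrMr ?ltr_wpDl ?mulr_ge0// mul1r; lra.
by apply: le_trans (lerD h1 h2) _; lra.
Unshelve. all: by end_near. Qed.

Lemma weakLnorm_le_of_conv_bound (r K : R) (g : Rn -> R) : 1 < r -> 0 <= K ->
  inL1 mu g ->
  (forall f, inL1 mu f ->
     (weakLnorm mu r (Defs.conv mu g f) <= K%:E * L1norm mu f)%E) ->
  (weakLnorm mu r g <= (2 * K)%:E)%E.
Proof.
move=> r1 K0 ig TK; have r0 : 0 < r by rewrite (lt_trans _ r1).
have [mg tg] := translation_continuous_inL1 mu_leb ig.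
have mu_sf := lebesgue_sigma_finite mu_leb.
apply/ereal_supP => _ [l /= l0 <-].
have Kl0 : 0 <= 2 * K / l by rewrite divr_ge0 ?mulr_ge0// ltW.
(* The weak norm bound at a single level [l], solved for the measure so that measures of two sets
   can be added. *)
suff Mg : (mu [set x | (l < `|g x|)%R] <= ((2 * K / l) `^ r)%:E)%E.
  have le_r : ((mu [set x | (l < `|g x|)%R]) `^ r^-1 <= (2 * K / l)%:E)%E.
    rewrite [leRHS](_ : _ = (((2 * K / l) `^ r)%:E `^ r^-1)%E).
      by apply: ge0_le_poweR => //; rewrite invr_ge0 ltW.
    by rewrite poweR_EFin -powRrM mulfV ?gt_eqF// powRr1.
  apply: le_trans (lee_wpmul2l _ le_r) _; first by rewrite lee_fin ltW.
  by rewrite -EFinM lee_fin mulrC divfK// gt_eqF.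
apply/lee_addgt0Pr => e e0.
(* The tolerance is chosen so that the deviation set at level [l * m / 2], with [m] the volume of
   the cube, has measure at most [e]. *)
have [d d0 hd] := tg (e * l / 2) ltac:(by rewrite divr_gt0 ?mulr_gt0).
have mQ : measurable (cube d : set Rn) by exact: measurable_cube.
have Qoo : (mu (cube d) < +oo)%E by exact: mu_box_lty.
have [m m0 Qm] : exists2 m : R, 0 < m & mu (cube d) = m%:E.
  exists (\prod_(i < n) (tnth [tuple d | i < n] i - tnth [tuple - d | i < n] i)).
    by apply: prodr_gt0 => i _; rewrite !tnth_mktuple opprK addr_gt0.
  by apply: mu_leb => i; rewrite !tnth_mktuple ge0_cp ?ltW.
have iQ : inL1 mu \1_(cube d).
  split; first exact: measurable_indic.
  apply/integrableP; split; first by apply/measurable_EFinP; exact: measurable_indic.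
  under eq_integral do rewrite /= ger0_norm//.
  by rewrite integral_indic// setIT.
have nQ : L1norm mu \1_(cube d) = m%:E.
  rewrite /L1norm; under eq_integral do rewrite ger0_norm//.
  by rewrite integral_indic// setIT.
have mT : measurable_fun setT (Defs.conv mu g \1_(cube d)).
  exact: (measurable_conv (msigma_finite mu_sf) mg (proj1 iQ)).
have lm0 : 0 < l * m / 2 by rewrite divr_gt0 ?mulr_gt0.
(* The indicator of the cube has norm [m], which cancels against the level [l * m / 2]: the bound
   does not depend on [d], hence not on [e]. *)
have A1 : (mu [set x | (l * m / 2 < `|Defs.conv mu g \1_(cube d) x|)%R] <=
    ((2 * K / l) `^ r)%:E)%E.
  set A := [set x | _].
  have : ((l * m / 2)%:E * (mu A) `^ r^-1 <= (K * m)%:E)%E.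
    rewrite [(K * m)%:E]EFinM -nQ; apply: le_trans (TK _ iQ).
    by apply: ereal_sup_ubound; exists (l * m / 2).
  rewrite -[leLHS]muleC -lee_pdivlMr// -EFinM.
  rewrite (_ : K * m * (l * m / 2)^-1 = 2 * K / l); last first.
    by field; rewrite !gt_eqF.
  move=> Ar; rewrite -[mu A]poweRe1 ?measure_ge0// -[X in (_ `^ X)%E](mulVf (lt0r_neq0 r0)).
  by rewrite poweRrM -poweR_EFin (ge0_le_poweR (ltW r0) (poweR_ge0 _ _) Ar).
(* With [D = cube d] the tail term is zero, leaving [e * l / 2 * m] on the right. *)
have A2 : (mu [set x | (l * m / 2 <
    `|Defs.conv mu g \1_(cube d) x - g x * m|)%R] <= e%:E)%E.
  have := conv_indic_deviation mu_sf ig mQ Qoo (ltW _) lm0 hd.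
  rewrite setDv measure0 mule0 adde0 Qm/= => /(_ _)/le_trans h.
  rewrite -(@lee_pmul2l _ (l * m / 2)%:E)// ?lte_fin//; apply: h.
    by rewrite divr_gt0 ?mulr_gt0.
  by rewrite -!EFinM lee_fin; lra.
apply: le_trans (leeD A1 A2); apply: le_trans (measureU2 _ _ _).
- apply: le_measure; rewrite ?inE.
  + exact: measurable_superlevel.
  + by apply: measurableU; apply: measurable_superlevel => //;
      apply: measurable_funB => //; exact: measurable_funM.
  + move=> x /= lg.
    have [h|h] := ltP (l * m / 2) `|Defs.conv mu g \1_(cube d) x|; [by left|right].
    (* If [|g x| * m] exceeds [l * m] and the convolution is at most half of that, the deviation
       exceeds the other half. *)
    have : l * m < `|g x| * m by rewrite ltr_pM2r.
    rewrite -{2}(gtr0_norm m0) -normrM => lgm.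
    have := ler_normB (Defs.conv mu g \1_(cube d) x)
                      (Defs.conv mu g \1_(cube d) x - g x * m).
    by rewrite opprB addrC subrK; lra.
- exact: measurable_superlevel.
- by apply: measurable_superlevel; apply: measurable_funB => //; exact: measurable_funM.
Qed.

End approximate_identity.

Theorem theorem5p4 (R : realType) :
  exists C : R, 0 < C /\
  forall (n : nat) (r : R)
    (mu : {measure set (n.-tuple R) -> \bar R})
    (V : {measure set (n.-tuple R) -> \bar R}) (g : n.-tuple R -> R),
    (0 < n)%N -> 1 < r -> is_lebesgue_measure mu ->
    (V [set: n.-tuple R] < +oo)%E -> V `<< mu ->
    inL1 mu g -> (opnorm_L1_weakLr mu r g < +oo)%E ->
    ((weakLnorm mu r g < +oo)%E /\
     (weakLnorm mu r g <= C%:E * opnorm_L1_weakLr mu r g)%E) /\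
    (forall lam : R, 0 < lam ->
      (fun t : R => mu [set x | lam <
          `|convm (dilate V t) g x - g x * fine (V [set: n.-tuple R])|])
        @ 0^'+ --> 0%E).
Proof.
exists 2; split => // n r mu V g _ r1 mu_leb Voo _ ig Too.
split; last by move=> l l0; exact: convm_dilate_cvg_in_measure.
have gT : (weakLnorm mu r g <= 2%:E * opnorm_L1_weakLr mu r g)%E.
  (* With the factor 2 moved to the left, the bound against the infimum is tested on each admissible
     [K]. *)
  rewrite -lee_pdivrMl//; apply/ereal_infP => _ [K /= [K0 TK] <-].
  by rewrite lee_pdivrMl// -EFinM; exact: weakLnorm_le_of_conv_bound.
by split => //; apply: le_lt_trans gT _; rewrite lte_mul_pinfty.
Qed.
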